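(* Let $X_0 \in \mathbb{R}^{n\times p}$ and $\lambda>0$ be such that for every $y\in\mathbb{R}^n$ the lasso problem $\min_{\beta_0\in\mathbb{R}^p}\frac12\|y-X_0\beta_0\|_2^2+\lambda\|\beta_0\|_1$ has a unique minimizer. Let $X=(X_0,\,-X_0)$, and let $\mathcal{CH}(X)$ be the convex hull of the columns of $X$. For every $S\subset\{1,\dots,2p\}$, $A_S\neq\emptyset$ if and only if the columns of $X$ indexed by $S$ form a face of $\mathcal{CH}(X)$.
   Context: Let $X=(X_0,-X_0)\in\mathbb{R}^{n\times 2p}$. The lasso problem is equivalently written as: minimize $\frac12\|y-X\beta\|_2^2+\lambda\sum_{j=1}^{2p}\beta_j$ over $\beta\in\mathbb{R}^{2p}$ with $\beta\ge 0$ (coordinatewise), where $\beta=(\beta_0^+,\beta_0^-)$ consists of the positive and negative parts of $\beta_0$. Uniqueness of the lasso minimizer for every $y$ gives a unique solution $\beta(y)$ of this problem for every $y$. Define $\mathrm{supp}(\beta)=\{1\le j\le 2p:\beta_j>0\}$. A signed model is a subset $S\subset\{1,\dots,2p\}$, and $A_S=\{y\in\mathbb{R}^n:\mathrm{supp}(\beta(y))=S\}$. A signed model $S$ is called accessible if $A_S\neq\emptyset$. The columns indexed by $S$ ''form a face'' of $\mathcal{CH}(X)$ if there is a face of $\mathcal{CH}(X)$ whose vertices are exactly the columns of $X$ indexed by $S$, with $S$ the set of all indices of these vertices. Faces here are proper faces (not $\mathcal{CH}(X)$ itself); the empty face is included and corresponds to $S=\emptyset$. *)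

(* Defs.v *)
From HB Require Import structures.
From mathcomp Require Import all_boot all_order all_algebra.
From mathcomp Require Import boolp classical_sets reals.

Set Implicit Arguments.
Unset Strict Implicit.
Unset Printing Implicit Defensive.

Import Order.TTheory GRing.Theory Num.Theory.

Local Open Scope classical_set_scope.
Local Open Scope ring_scope.

Section Lasso.
Context {R : realType}.

Definition minimizer {T : Type} (D : set T) (f : T -> R) (x : T) : Prop :=
  D x /\ forall z, D z -> f x <= f z.

Definition sqnorm2 {n : nat} (v : 'cV[R]_n) : R := \sum_(i < n) v i 0 ^+ 2.

Definition norm1 {n : nat} (v : 'cV[R]_n) : R := \sum_(i < n) `|v i 0|.

Definition lasso_obj {n p : nat} (X0 : 'M[R]_(n, p)) (lambda : R)
    (y : 'cV[R]_n) (b0 : 'cV[R]_p) : R :=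
  2^-1 * sqnorm2 (y - X0 *m b0) + lambda * norm1 b0.

Definition lasso_unique {n p : nat} (X0 : 'M[R]_(n, p)) (lambda : R) : Prop :=
  forall y : 'cV[R]_n,
    exists! b0 : 'cV[R]_p, minimizer setT (lasso_obj X0 lambda y) b0.

Definition signed_design {n p : nat} (X0 : 'M[R]_(n, p)) : 'M[R]_(n, p + p) :=
  row_mx X0 (- X0).

Definition nonneg_vectors {m : nat} : set 'cV[R]_m :=
  [set b | forall j, 0 <= b j 0].

Definition nnlasso_obj {n m : nat} (X : 'M[R]_(n, m)) (lambda : R)
    (y : 'cV[R]_n) (b : 'cV[R]_m) : R :=
  2^-1 * sqnorm2 (y - X *m b) + lambda * \sum_(j < m) b j 0.

(* The default value 0 is only returned when there is no minimizer; when X is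
   the signed design of an X0 satisfying [lasso_unique], the minimizer exists
   and is unique. *)
Definition nnlasso_sol {n m : nat} (X : 'M[R]_(n, m)) (lambda : R)
    (y : 'cV[R]_n) : 'cV[R]_m :=
  xget 0 [set b | minimizer nonneg_vectors (nnlasso_obj X lambda y) b].

Definition supp {m : nat} (b : 'cV[R]_m) : {set 'I_m} :=
  [set j | 0 < b j 0]%SET.

Definition model_region {n m : nat} (X : 'M[R]_(n, m)) (lambda : R)
    (S : {set 'I_m}) : set 'cV[R]_n :=
  [set y | supp (nnlasso_sol X lambda y) = S].

Definition convex_hull_cols {n m : nat} (X : 'M[R]_(n, m)) : set 'cV[R]_n :=
  [set x | exists a : 'cV[R]_m,
     [/\ forall j, 0 <= a j 0, \sum_(j < m) a j 0 = 1 & x = X *m a]].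

Definition dotv {n : nat} (c x : 'cV[R]_n) : R := \sum_(i < n) c i 0 * x i 0.

(* A face of a polytope is its intersection with the equality set of a linear
   inequality valid on it; c = 0 gives the empty face (c0 = 1) and the polytope
   itself (c0 = 0). *)
Definition face {n : nat} (P F : set 'cV[R]_n) : Prop :=
  exists (c : 'cV[R]_n) (c0 : R),
    (forall x, P x -> dotv c x <= c0) /\ F = P `&` [set x | dotv c x = c0].

(* The empty face is allowed even when P itself is empty, which happens for the
   convex hull of the columns of a matrix with no columns. *)
Definition proper_face {n : nat} (P F : set 'cV[R]_n) : Prop :=
  face P F /\ (F <> P \/ F = set0).

Definition vertices {n : nat} (P : set 'cV[R]_n) : set 'cV[R]_n :=
  [set v | face P [set v]].

(* The last clause matters when X has repeated columns: S must contain every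
   index of each vertex. *)
Definition forms_face {n m : nat} (X : 'M[R]_(n, m)) (S : {set 'I_m}) : Prop :=
  exists F : set 'cV[R]_n,
    [/\ proper_face (convex_hull_cols X) F,
        vertices F = [set col j X | j in [set` S]] &
        forall j, vertices F (col j X) -> j \in S].

End Lasso.

(* Main.v *)
(** The KKT conditions say that [b] solves the nonnegative problem at [y] iff
    the residual [c = y - X b] satisfies [c . X_j <= lambda] for all [j], with
    equality on the support of [b].  If [S] forms a face, scaling a normal
    vector of that face gives such a [c], and [y = c + X 1_S] has solution
    [1_S].  Conversely, let [E] be the equality set of the residual at a [y] in
    the region of [S].  Every nonnegative vector supported on [E] is a solution
    for the same residual, so uniqueness makes the columns indexed by [E]
    linearly independent; tilting [c] then yields, for each subset [T] of [E],
    a supporting hyperplane meeting the columns exactly in [T].  The cases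
    [T = S] and [T = {j}] give the face and its vertices. *)
Require Import Defs.
From mathcomp Require Import all_boot all_order all_algebra.
From mathcomp Require Import boolp classical_sets reals.
From mathcomp Require Import ring lra.

Set Implicit Arguments.
Unset Strict Implicit.
Unset Printing Implicit Defensive.

Import Order.TTheory GRing.Theory Num.Theory.

Local Open Scope classical_set_scope.
Local Open Scope ring_scope.

(** * Inner products, squared norms and small perturbations *)

Section Dotv.
Context {R : realType}.

Lemma dotvC n (c x : 'cV[R]_n) : dotv c x = dotv x c.
Proof. by apply: eq_bigr => i _; rewrite mulrC. Qed.

Lemma dotvZl n a (c x : 'cV[R]_n) : dotv (a *: c) x = a * dotv c x.
Proof. by rewrite /dotv mulr_sumr; apply: eq_bigr => i _; rewrite mxE mulrA. Qed.

Lemma dotvDl n (c d x : 'cV[R]_n) : dotv (c + d) x = dotv c x + dotv d x.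
Proof. by rewrite -big_split /=; apply: eq_bigr => i _; rewrite mxE mulrDl. Qed.

Lemma dotvNr n (c x : 'cV[R]_n) : dotv c (- x) = - dotv c x.
Proof. by rewrite dotvC -scaleN1r dotvZl mulN1r dotvC. Qed.

Lemma dotv_mulmx n m (c : 'cV[R]_n) (X : 'M[R]_(n, m)) (a : 'cV[R]_m) :
  dotv c (X *m a) = \sum_j dotv c (col j X) * a j 0.
Proof.
rewrite /dotv; under eq_bigr => i _ do rewrite mxE mulr_sumr.
rewrite exchange_big /=; apply: eq_bigr => j _; rewrite mulr_suml.
by apply: eq_bigr => i _; rewrite mxE mulrA.
Qed.

Lemma sqnorm2_ge0 n (v : 'cV[R]_n) : 0 <= sqnorm2 v.
Proof. by apply: sumr_ge0 => i _; rewrite sqr_ge0. Qed.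

Lemma sqnorm2B n (v w : 'cV[R]_n) :
  sqnorm2 (v - w) = sqnorm2 v - 2 * dotv v w + sqnorm2 w.
Proof.
rewrite /sqnorm2 /dotv mulr_sumr -sumrB -big_split /=.
by apply: eq_bigr => i _; rewrite !mxE; ring.
Qed.

Lemma sqnorm2Z n a (v : 'cV[R]_n) : sqnorm2 (a *: v) = a ^+ 2 * sqnorm2 v.
Proof.
by rewrite /sqnorm2 mulr_sumr; apply: eq_bigr => i _; rewrite mxE exprMn.
Qed.

(** A minimum over the finite index set gives the scale; the [+ 1] keeps the denominators positive
    and the inequality strict. *)
Lemma exists_small_scale (I : finType) (P : pred I) (f g : I -> R) :
  (forall i, P i -> 0 < f i) ->
  exists2 e, 0 < e & forall i, P i -> e * g i < f i.
Proof.
move=> f_gt0; pose e := \big[Num.min/1]_(i | P i) (f i / (`|g i| + 1)).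
have g1_gt0 i : 0 < `|g i| + 1 by rewrite ltr_wpDl.
have e_gt0 : 0 < e.
  by apply: lt_bigmin => // i Pi; rewrite divr_gt0 ?f_gt0.
exists e => // i Pi.
have : e <= f i / (`|g i| + 1) by apply: bigmin_le_cond.
rewrite ler_pdivlMr // => le_f; apply: lt_le_trans le_f.
by rewrite ltr_pM2l // (le_lt_trans (ler_norm _)) // ltrDl.
Qed.

End Dotv.

(** * Optimality conditions of the nonnegative lasso *)

Section NonnegativeLasso.
Context {R : realType}.
Variables (n m : nat) (X : 'M[R]_(n, m)) (lambda : R).
Implicit Types (c y : 'cV[R]_n) (b d z : 'cV[R]_m).

Definition nnlasso_minimizers y : set 'cV[R]_m :=
  [set b | minimizer nonneg_vectors (nnlasso_obj X lambda y) b].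

(** The residual [c] is a free variable, not tied to [y - X *m b], so that one [c] can be paired
    with several [b]. *)
Definition kkt c b : Prop :=
  [/\ forall j, 0 <= b j 0, forall j, dotv c (col j X) <= lambda &
      forall j, 0 < b j 0 -> dotv c (col j X) = lambda].

(** Exact expansion of a quadratic; the linear coefficients are the slacks of the KKT
    inequalities. *)
Lemma nnlasso_objD y b d :
  nnlasso_obj X lambda y (b + d) = nnlasso_obj X lambda y b +
    2^-1 * sqnorm2 (X *m d) +
    \sum_j (lambda - dotv (y - X *m b) (col j X)) * d j 0.
Proof.
under [X in _ = _ + X]eq_bigr => j _ do rewrite mulrBl.
rewrite sumrB -dotv_mulmx -mulr_sumr /nnlasso_obj mulmxDr opprD addrA sqnorm2B.
under [X in lambda * X]eq_bigr => j _ do rewrite mxE.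
by rewrite big_split /=; field.
Qed.

Lemma kkt_minimizer c b : kkt c b -> nnlasso_minimizers (c + X *m b) b.
Proof.
move=> [b_ge0 c_le c_eq]; split=> // z z_ge0.
rewrite -(subrKC b z) nnlasso_objD addrK -addrA lerDl addr_ge0 //.
  by rewrite mulr_ge0 ?invr_ge0 ?sqnorm2_ge0.
apply: sumr_ge0 => j _; rewrite !mxE.
(* Either [b j 0] is zero and the increment is [z j 0], or the slack vanishes. *)
have := b_ge0 j; rewrite le_eqVlt => /orP[/eqP <-|/c_eq ->].
  by rewrite subr0 mulr_ge0 ?subr_ge0 ?c_le //; apply: z_ge0.
by rewrite subrr mul0r.
Qed.

(** The linear gain beats the quadratic cost for short steps; the cap [u] serves to keep a decreased
    coordinate nonnegative. *)
Lemma small_step_descent (q g u : R) : 0 <= q -> 0 < g -> 0 < u ->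
  exists t, [/\ 0 < t, t <= u & 2^-1 * (t ^+ 2 * q) < g * t].
Proof.
move=> q_ge0 g_gt0 u_gt0; have q1_gt0 : 0 < q + 1 by lra.
exists (Num.min u (g / (q + 1))).
set t := Num.min _ _.
have t_gt0 : 0 < t by rewrite lt_min u_gt0 divr_gt0.
split; rewrite // ?ge_min ?lexx //.
have : t <= g / (q + 1) by rewrite ge_min lexx orbT.
rewrite ler_pdivlMr // => le_g.
have tq_ge0 : 0 <= t * q by rewrite mulr_ge0 // ltW.
have -> : 2^-1 * (t ^+ 2 * q) = (2^-1 * (t * q)) * t by ring.
by rewrite ltr_pM2r //; lra.
Qed.

Lemma minimizer_kkt y b : nnlasso_minimizers y b -> kkt (y - X *m b) b.
Proof.
move=> [b_ge0 b_min].
(* Compare [b] with its move by [t], of either sign, along one coordinate. *)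
have step j t : 0 <= b j 0 + t ->
    0 <= 2^-1 * (t ^+ 2 * sqnorm2 (col j X)) +
         (lambda - dotv (y - X *m b) (col j X)) * t.
  move=> bt_ge0.
  have /b_min : nonneg_vectors (b + t *: delta_mx j 0).
    move=> k; rewrite !mxE eqxx andbT.
    by case: eqP => [->|_]; rewrite ?mulr1 // mulr0 addr0; apply: b_ge0.
  rewrite nnlasso_objD -addrA lerDl -scalemxAr -colE sqnorm2Z.
  rewrite (bigD1 j) //= big1 => [|k /negPf kj].
    by rewrite !mxE !eqxx mulr1 addr0.
  by rewrite !mxE kj /= !mulr0.
have c_le j : dotv (y - X *m b) (col j X) <= lambda.
  rewrite leNgt; apply/negP; rewrite -subr_gt0 => g_gt0.
  have [t [t_gt0 _ lt_t]] :=
    small_step_descent (sqnorm2_ge0 (col j X)) g_gt0 ltr01.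
  have bt : 0 <= b j 0 + t by rewrite addr_ge0 ?b_ge0 // ltW.
  have := step j t bt; nra.
(* A positive coordinate can also be decreased, which excludes a positive slack. *)
split=> // j bj_gt0; apply/eqP; rewrite eq_le c_le /=.
rewrite leNgt; apply/negP; rewrite -subr_gt0 => g_gt0.
have [t [t_gt0 le_t lt_t]] :=
  small_step_descent (sqnorm2_ge0 (col j X)) g_gt0 bj_gt0.
have bt : 0 <= b j 0 + - t by rewrite subr_ge0.
by have := step j _ bt; rewrite sqrrN mulrN; lra.
Qed.

Definition nnlasso_unique : Prop :=
  forall y, exists! b, nnlasso_minimizers y b.

(** * Consequences of uniqueness: independence of the equality columns *)

Section Unique.
Hypothesis X_unique : nnlasso_unique.

Lemma nnlasso_solP y b :
  nnlasso_minimizers y b <-> nnlasso_sol X lambda y = b.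
Proof.
have [b0 [b0_min b0_unique]] := X_unique y.
have sol_min : nnlasso_minimizers y (nnlasso_sol X lambda y).
  exact: (@xgetPex _ 0 (nnlasso_minimizers y)) (ex_intro _ b0 b0_min).
split=> [b_min|<- //].
by rewrite -(b0_unique _ b_min) -(b0_unique _ sol_min).
Qed.

Lemma kkt_sol c b : kkt c b -> nnlasso_sol X lambda (c + X *m b) = b.
Proof. by move/kkt_minimizer/nnlasso_solP. Qed.

Lemma sol_kkt y :
  kkt (y - X *m nnlasso_sol X lambda y) (nnlasso_sol X lambda y).
Proof. exact/minimizer_kkt/nnlasso_solP. Qed.

(* The positive and negative parts of [d] satisfy the KKT conditions with the
   same residual, and they have the same image under [X]. *)
Lemma equality_columns_free c d :
  (forall j, dotv c (col j X) <= lambda) ->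
  (forall j, d j 0 != 0 -> dotv c (col j X) = lambda) ->
  X *m d = 0 -> d = 0.
Proof.
move=> c_le d_supp Xd0.
pose dp : 'cV[R]_m := \col_j Num.max (d j 0) 0.
pose dn : 'cV[R]_m := \col_j Num.max (- d j 0) 0.
have dE : d = dp - dn.
  apply/colP => j; rewrite !mxE.
  have [h|h] := leP (d j 0) 0.
    by rewrite sub0r max_l ?opprK // oppr_ge0.
  by rewrite max_r ?subr0 // oppr_le0 ltW.
have kkt_p : kkt c dp.
  split=> // j; rewrite mxE ?le_max ?lexx ?orbT // lt_max ltxx orbF.
  by move=> /lt0r_neq0/d_supp.
have kkt_n : kkt c dn.
  split=> // j; rewrite mxE ?le_max ?lexx ?orbT // lt_max ltxx orbF.
  by move=> /lt0r_neq0; rewrite oppr_eq0 => /d_supp.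
have XE : X *m dp = X *m dn.
  by apply/eqP; rewrite -subr_eq0 -mulmxBr -dE Xd0.
by rewrite dE -(kkt_sol kkt_p) -(kkt_sol kkt_n) XE subrr.
Qed.

(** Linear functionals take arbitrary prescribed values on independent columns; here 0 on [S] and 1
    off it. *)
Lemma separate_equality_columns c (S : {set 'I_m}) :
  (forall j, dotv c (col j X) <= lambda) ->
  exists w, forall j, dotv c (col j X) = lambda ->
    dotv w (col j X) = (j \notin S)%:R.
Proof.
move=> c_le.
pose e : 'rV[R]_m := \row_j (dotv c (col j X) == lambda)%:R.
pose t : 'rV[R]_m := \row_j ((dotv c (col j X) == lambda) && (j \notin S))%:R.
pose A := X *m diag_mx e.
have te : t = t *m diag_mx e.
  apply/rowP => j; rewrite mul_mx_diag !mxE.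
  by case: eqP; rewrite /= ?mulr1 ?mulr0.
(* [t] is in the row space of [A] once it kills the cokernel. The columns of
   [diag_mx e *m cokermx A] are supported on the equality set and killed by [X], hence zero. *)
have : (t <= A)%MS.
  rewrite submxE te -mulmxA; apply/eqP.
  suff -> : diag_mx e *m cokermx A = 0 by rewrite mulmx0.
  apply/matrixP => i k; rewrite [RHS]mxE.
  suff /colP/(_ i) : col k (diag_mx e *m cokermx A) = 0 by rewrite mxE [RHS]mxE.
  apply: (equality_columns_free c_le) => [j|].
    rewrite mxE mul_diag_mx !mxE;
    have [->|/negPf _] := eqVneq (dotv c _) lambda => //.
    by rewrite mul0r eqxx.
  by rewrite colE 2!mulmxA -/A mulmx_coker mul0mx.
move=> /submxP[D tE]; exists D^T => j jE.
have /rowP/(_ j) := tE; rewrite mulmxA mul_mx_diag !mxE jE eqxx mulr1 /= => ->.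
by apply: eq_bigr => i _; rewrite !mxE.
Qed.

(** Subtract a small multiple of the separating functional: columns in [S] keep the value [lambda],
    the other equality columns drop below it, and strict inequalities survive. *)
Lemma tilt_hyperplane c (S : {set 'I_m}) :
  (forall j, dotv c (col j X) <= lambda) ->
  (forall j, j \in S -> dotv c (col j X) = lambda) ->
  exists2 c', forall j, dotv c' (col j X) <= lambda &
    forall j, dotv c' (col j X) = lambda <-> j \in S.
Proof.
move=> c_le cS; have [w wE] := separate_equality_columns S c_le.
have [e e_gt0 e_small] : exists2 e, 0 < e &
    forall j, dotv c (col j X) != lambda ->
      e * - dotv w (col j X) < lambda - dotv c (col j X).
  by apply: exists_small_scale => j neq; rewrite subr_gt0 lt_neqAle neq c_le.
have cE j : dotv (c + (- e) *: w) (col j X) =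
    dotv c (col j X) + - e * dotv w (col j X) by rewrite dotvDl dotvZl.
have [inS notinS] : (forall j, j \in S ->
      dotv (c + (- e) *: w) (col j X) = lambda) /\
    (forall j, j \notin S -> dotv (c + (- e) *: w) (col j X) < lambda).
  split=> j jS; rewrite cE.
    by rewrite wE ?cS // jS mulr0 addr0.
  have [eq|/e_small/=] := eqVneq (dotv c (col j X)) lambda; last by lra.
  by rewrite wE // jS eq /=; lra.
exists (c + (- e) *: w) => j; have [jS|jS] := boolP (j \in S).
- by rewrite inS.
- exact/ltW/notinS.
- by split=> // _; apply: inS.
- by split=> // eq; have := notinS j jS; rewrite eq ltxx.
Qed.

End Unique.
End NonnegativeLasso.

(** * Faces and vertices of the convex hull of the columns *)

Section ConvexHull.
Context {R : realType}.
Variables (n m : nat) (X : 'M[R]_(n, m)).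
Implicit Type x : 'cV[R]_n.

Lemma col_convex_hull j : convex_hull_cols X (col j X).
Proof.
exists (delta_mx j 0); split; last by rewrite colE.
  by move=> k; rewrite mxE eqxx andbT ler0n.
rewrite (bigD1 j) //= big1 => [|k /negPf kj]; last by rewrite mxE kj.
by rewrite mxE !eqxx addr0.
Qed.

Lemma convex_hull_dotv_le c c0 x :
  (forall j, dotv c (col j X) <= c0) -> convex_hull_cols X x -> dotv c x <= c0.
Proof.
move=> c_le [a [a_ge0 a_sum ->]].
rewrite dotv_mulmx -[c0]mulr1 -a_sum mulr_sumr ler_sum // => j _.
exact: ler_wpM2r.
Qed.

(** A weighted mean of values at most [c0] reaches [c0] only if every value with nonzero weight
    does. The bound is asked only at those, so that a functional valid on a face alone qualifies. *)
Lemma convex_combination_dotv_eq c c0 (a : 'cV[R]_m) j :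
  (forall k, a k 0 != 0 -> dotv c (col k X) <= c0) ->
  (forall k, 0 <= a k 0) -> \sum_k a k 0 = 1 -> dotv c (X *m a) = c0 ->
  a j 0 != 0 -> dotv c (col j X) = c0.
Proof.
move=> c_le a_ge0 a_sum /eqP; rewrite dotv_mulmx eq_sym -subr_eq0.
rewrite -[X in X - _]mulr1 -a_sum mulr_sumr -sumrB psumr_eq0; last first.
  move=> k _; rewrite -mulrBl; have [->|/c_le ck] := eqVneq (a k 0) 0.
    by rewrite mulr0.
  by rewrite mulr_ge0 // subr_ge0.
move=> /allP/(_ j (mem_index_enum _)) /=; rewrite -mulrBl mulf_eq0 subr_eq0.
by case/orP => [/eqP ->|->].
Qed.

Lemma face_singleton c c0 j :
  (forall k, dotv c (col k X) <= c0) ->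
  (forall k, dotv c (col k X) = c0 <-> k = j) ->
  face (convex_hull_cols X) [set col j X].
Proof.
move=> c_le c_eq; exists c, c0; split=> [x|]; first exact: convex_hull_dotv_le.
apply/seteqP; split=> [_ ->|x] /=.
  by split; [exact: col_convex_hull | apply/c_eq].
move=> [[a [a_ge0 a_sum ->]] aE].
have a0 k : k != j -> a k 0 = 0.
  apply: contra_neq_eq => ak; apply/c_eq.
  exact: (convex_combination_dotv_eq _ a_ge0 a_sum aE ak).
rewrite colE; congr (_ *m _); apply/colP => k; rewrite mxE eqxx andbT.
have [->|/a0 //] := eqVneq k j.
by rewrite -a_sum (bigD1 j) //= big1 ?addr0 // => i /a0.
Qed.

Lemma hyperplane_forms_face c c0 (S : {set 'I_m}) :
  (forall j, dotv c (col j X) <= c0) ->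
  (forall j, dotv c (col j X) = c0 <-> j \in S) ->
  proper_face (convex_hull_cols X)
    (convex_hull_cols X `&` [set x | dotv c x = c0]) ->
  (forall j, j \in S -> face (convex_hull_cols X) [set col j X]) ->
  forms_face X S.
Proof.
move=> c_le c_eq properF exposed; set F := _ `&` _ in properF.
have colF j : F (col j X) <-> j \in S.
  by split=> [[_ /c_eq //]|/c_eq cj]; split=> //; exact: col_convex_hull.
exists F; split=> // [|j [d [d0 [_ /seteqP[/(_ _ erefl)[/colF]]]]] //].
apply/seteqP; split=> [v|_ [j /= jS <-]].
  move=> [d [d0 [d_le vE]]].
  have [[[a [a_ge0 a_sum vXa]] cv] dv] : (F `&` [set x | dotv d x = d0]) v.
    by rewrite -vE.
  (* A column with weight in [v] lies in [F] and attains the bound of the functional exposing [v],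
     so it equals [v]. *)
  have [j aj] : exists j, a j 0 != 0.
    apply: contrapT => /forallNP a0; move: a_sum.
    rewrite big1 => [/eqP|j _]; first by rewrite eq_sym oner_eq0.
    by apply/eqP/negPn/negP; exact: a0.
  rewrite /= vXa in cv dv.
  have aF k : a k 0 != 0 -> F (col k X).
    move=> ak; split; first exact: col_convex_hull.
    exact: (convex_combination_dotv_eq _ a_ge0 a_sum cv ak).
  exists j; first exact/colF/aF.
  suff : [set v] (col j X) by [].
  rewrite vE; split; first exact: aF.
  by apply: (convex_combination_dotv_eq _ a_ge0 a_sum dv aj) => k /aF/d_le.
(* A functional exposing the column in the hull also exposes it in the face. *)
have [d [d0 [d_le jE]]] := exposed j jS.
exists d, d0; split=> [x [/d_le]//|].
rewrite /F setIAC -jE; apply/seteqP; split=> [_ ->|x []//].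
by split=> //; apply/c_eq.
Qed.

End ConvexHull.

(** * The signed design: reduction from the lasso and central symmetry *)

Section SignedDesign.
Context {R : realType}.
Variables (n p : nat) (X0 : 'M[R]_(n, p)) (lambda : R).
Hypothesis lambda_gt0 : 0 < lambda.
Implicit Types (b : 'cV[R]_p) (z : 'cV[R]_(p + p)).

Let X := signed_design X0.

Definition signed_parts b : 'cV[R]_(p + p) :=
  col_mx (\col_i Num.max (b i 0) 0) (\col_i Num.max (- b i 0) 0).

Definition signed_diff z : 'cV[R]_p := usubmx z - dsubmx z.

Lemma signed_design_mulmx z : X *m z = X0 *m signed_diff z.
Proof.
by rewrite -{1}[z]vsubmxK mul_row_col mulNmx -mulmxBr.
Qed.

Lemma signed_partsK b : signed_diff (signed_parts b) = b.
Proof.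
rewrite /signed_diff col_mxKu col_mxKd; apply/colP => i; rewrite !mxE.
have [h|h] := leP (b i 0) 0.
  by rewrite sub0r max_l ?opprK // oppr_ge0.
by rewrite max_r ?subr0 // oppr_le0 ltW.
Qed.

Lemma signed_parts_ge0 b : nonneg_vectors (signed_parts b).
Proof. by move=> j; rewrite mxE; case: split => i; rewrite mxE le_max lexx orbT. Qed.

Lemma sum_signed_parts b : \sum_j signed_parts b j 0 = norm1 b.
Proof.
rewrite big_split_ord /= -big_split /=; apply: eq_bigr => i _.
rewrite col_mxEu col_mxEd !mxE.
have [h|h] := leP (b i 0) 0.
  by rewrite add0r max_l ?oppr_ge0 // ler0_norm.
by rewrite max_r ?addr0 ?gtr0_norm // oppr_le0 ltW.
Qed.

Lemma norm1_signed_diff z :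
  nonneg_vectors z -> norm1 (signed_diff z) <= \sum_j z j 0.
Proof.
move=> z_ge0; rewrite big_split_ord /= -big_split /=; apply: ler_sum => i _.
rewrite !mxE (le_trans (ler_normB _ _)) //.
by rewrite !ger0_norm //; apply: z_ge0.
Qed.

(** For nonnegative [u] and [v], equality in [|u - v| <= u + v] forces one of them to vanish. *)
Lemma norm1_signed_diff_eq z :
  nonneg_vectors z -> norm1 (signed_diff z) = \sum_j z j 0 ->
  z = signed_parts (signed_diff z).
Proof.
move=> z_ge0 /eqP.
rewrite big_split_ord /= -big_split /= eq_sym -subr_eq0 -sumrB psumr_eq0; last first.
  move=> i _; rewrite subr_ge0 !mxE (le_trans (ler_normB _ _)) //.
  by rewrite !ger0_norm //; apply: z_ge0.
move=> /allP z_eq; rewrite -{1}[z]vsubmxK; congr col_mx; apply/colP => i;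
  have := z_eq i (mem_index_enum _); rewrite /= !mxE subr_eq0 => /eqP;
  move: (z_ge0 (lshift p i)) (z_ge0 (rshift p i));
  move: (z (lshift p i) 0) (z (rshift p i) 0) => u v u_ge0 v_ge0;
  case: (ger0P (u - v)) => uv uvE;
  do ?[rewrite maxEle; case: ifPn; rewrite -?ltNge]; lra.
Qed.

Lemma nnlasso_signed_parts y b :
  nnlasso_obj X lambda y (signed_parts b) = lasso_obj X0 lambda y b.
Proof.
by rewrite /nnlasso_obj signed_design_mulmx signed_partsK sum_signed_parts.
Qed.

Lemma lasso_signed_diff y z : nonneg_vectors z ->
  lasso_obj X0 lambda y (signed_diff z) <= nnlasso_obj X lambda y z.
Proof.
move=> z_ge0; rewrite /nnlasso_obj signed_design_mulmx lerD2l ler_pM2l //.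
exact: norm1_signed_diff.
Qed.

(** The objectives agree at [signed_parts b], and passing from [z] to [signed_diff z] never
    increases the cost, so minimizers correspond. *)
Lemma signed_design_unique : lasso_unique X0 lambda -> nnlasso_unique X lambda.
Proof.
move=> X0_unique y; have [b [[_ b_min] b_unique]] := X0_unique y.
exists (signed_parts b); split=> [|z [z_ge0 z_min]].
  split=> [|z z_ge0]; first exact: signed_parts_ge0.
  by rewrite nnlasso_signed_parts (le_trans (b_min (signed_diff z) I)) //
      lasso_signed_diff.
have z_le : nnlasso_obj X lambda y z <= lasso_obj X0 lambda y b.
  by rewrite -nnlasso_signed_parts; apply/z_min/signed_parts_ge0.
have -> : b = signed_diff z.
  apply: b_unique; split=> // b' _.
  by rewrite (le_trans (lasso_signed_diff _ z_ge0)) // (le_trans z_le) // b_min.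
(* The quadratic terms at [z] and [signed_diff z] coincide, so optimality makes the norm inequality
   tight. *)
apply/esym/norm1_signed_diff_eq => //; apply/eqP.
rewrite eq_le norm1_signed_diff //=.
have := le_trans z_le (b_min (signed_diff z) I).
by rewrite /nnlasso_obj signed_design_mulmx lerD2l ler_pM2l.
Qed.

(** Columns come in opposite pairs, so swapping the two halves of the weights negates the point. *)
Lemma convex_hull_signed_opp x :
  convex_hull_cols X x -> convex_hull_cols X (- x).
Proof.
move=> [a [a_ge0 a_sum ->]]; exists (col_mx (dsubmx a) (usubmx a)); split.
- by move=> j; rewrite mxE; case: split => i; rewrite mxE.
- rewrite big_split_ord /= -a_sum [RHS]big_split_ord /= addrC.
  by congr (_ + _); apply: eq_bigr => i _; rewrite ?col_mxEu ?col_mxEd mxE.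
- rewrite !signed_design_mulmx /signed_diff col_mxKu col_mxKd.
  by rewrite -mulmxN opprB.
Qed.

(** A nonempty hull inside the hyperplane would contain some [x] and [- x], both at the positive
    level [lambda]. *)
Lemma hyperplane_proper_face c :
  (forall j, dotv c (col j X) <= lambda) ->
  proper_face (convex_hull_cols X)
    (convex_hull_cols X `&` [set x | dotv c x = lambda]).
Proof.
move=> c_le; split.
  by exists c, lambda; split=> // x; exact: convex_hull_dotv_le.
apply: contrapT => /not_orP[/contrapT /seteqP[_ PF] /eqP/set0P[x [Px cx]]].
have [_ /=] := PF _ (convex_hull_signed_opp Px).
by rewrite dotvNr cx => /eqP; rewrite eqNr gt_eqF.
Qed.

Lemma face_normal_scaled (F : set 'cV[R]_n) : F !=set0 ->
  proper_face (convex_hull_cols X) F ->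
  exists2 c, forall j, dotv c (col j X) <= lambda &
    forall x, F x -> dotv c x = lambda.
Proof.
move=> [x Fx] [[c [c0 [c_le FE]]] []]; last first.
  by move=> F0; rewrite F0 in Fx.
have [Px cx] : (convex_hull_cols X `&` [set x | dotv c x = c0]) x by rewrite -FE.
have c_ge y : convex_hull_cols X y -> - c0 <= dotv c y.
  by move=> /convex_hull_signed_opp/c_le; rewrite dotvNr; lra.
move=> FnP; have [c0_gt0|c0_le0] := ltP 0 c0.
  exists (lambda / c0 *: c) => [j|y]; rewrite dotvZl.
    have cj := c_le _ (col_convex_hull X j).
    rewrite -mulrA ger_pMr // mulrC ler_pdivrMr // mul1r.
    exact: cj.
  by rewrite FE => -[_ /= ->]; rewrite divfK // gt_eqF.
(* For [c0 <= 0] the symmetric bounds pin the functional to [c0] on the hull, so [F] would be all of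
   it. *)
exfalso; apply: FnP; rewrite FE; apply/setIidl => y Py /=.
by have := c_ge y Py; have := c_le y Py; lra.
Qed.

End SignedDesign.

(** * Accessible signed models and faces *)

Theorem theorem2p1 (R : realType) (n p : nat) (X0 : 'M[R]_(n, p)) (lambda : R)
    (lambda_gt0 : 0 < lambda) (X0_unique : lasso_unique X0 lambda)
    (S : {set 'I_(p + p)}) :
  model_region (signed_design X0) lambda S !=set0 <->
  forms_face (signed_design X0) S.
Proof.
have X_unique := signed_design_unique lambda_gt0 X0_unique.
split=> [[y /= yS]|[F [F_proper F_vertices _]]].
  have [_ c_le] := sol_kkt X_unique y.
  move: (y - _) c_le => c c_le c_supp.
  have cS j : j \in S -> dotv c (col j (signed_design X0)) = lambda.
    by rewrite -yS inE => /c_supp.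
  have [d d_le dS] := tilt_hyperplane X_unique c_le cS.
  apply: (hyperplane_forms_face d_le dS); first exact: hyperplane_proper_face.
  move=> j jS.
  have cj k : k \in [set j]%SET -> dotv c (col k (signed_design X0)) = lambda.
    by move=> /set1P ->; apply: cS.
  have [e e_le eE] := tilt_hyperplane X_unique c_le cj.
  apply: (face_singleton e_le) => k; rewrite eE.
  by split=> [/set1P //|->]; rewrite inE.
have colF j : j \in S -> F (col j (signed_design X0)).
  move=> jS; have : vertices F (col j (signed_design X0)).
    by rewrite F_vertices; exists j.
  by move=> [d [d0 [_ /seteqP[/(_ _ erefl)[]]]]].
have [c c_le cS] : exists2 c, forall j, dotv c (col j (signed_design X0)) <= lambda &
    forall j, j \in S -> dotv c (col j (signed_design X0)) = lambda.
  (* An empty [S] provides no point of [F] for scaling a normal; the zero residual serves. *)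
  have [S0|[j jS]] := set_0Vmem S.
    exists 0 => j; last by rewrite S0 inE.
    by rewrite -(scale0r 0) dotvZl mul0r ltW.
  have [|c c_le cF] := face_normal_scaled lambda_gt0 _ F_proper.
    by exists (col j (signed_design X0)); apply: colF.
  by exists c => // k /colF/cF.
pose b : 'cV[R]_(p + p) := \col_j (j \in S)%:R.
have b_kkt : kkt (signed_design X0) lambda c b.
  split=> // j; rewrite mxE ?ler0n // ltr0n.
  by case: (boolP (j \in S)) => // jS _; apply: cS.
exists (c + signed_design X0 *m b).
rewrite /model_region /= (kkt_sol X_unique b_kkt).
by apply/setP => j; rewrite inE mxE ltr0n lt0b.
Qed.
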